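(* If $(X,\mathcal{A})$ and $(Y,\mathcal{A}')$ are two compact $T$-measurable spaces, then $X\cong Y$ as measurable spaces if and only if $M(X)\cong M(Y)$ as rings.
   Context: A measurable space $(X,\mathcal{A})$ is a nonempty set $X$ with a $\sigma$-algebra $\mathcal{A}$ of subsets of $X$. $M(X)$ is the commutative ring (pointwise operations) of all functions $f:X\to\mathbb{R}$ with $f^{-1}(V)\in\mathcal{A}$ for every open $V\subseteq\mathbb{R}$; $M(Y)$ is defined likewise from $(Y,\mathcal{A}')$. A measurable space is $T$-measurable if whenever $x,y$ are distinct points of it, there is a measurable set containing one of them and not the other. $(X,\mathcal{A})$ is a compact measurable space if $\mathcal{A}$, ordered by inclusion, is a compact lattice, i.e. its top element $X$ is compact: whenever $X=\bigvee S$ with $S\subseteq\mathcal{A}$, there is a finite $T\subseteq S$ with $X=\bigvee T$. A compact $T$-measurable space is a measurable space that is both compact and $T$-measurable. Two measurable spaces $(X_1,\mathcal{A}_1)$ and $(X_2,\mathcal{A}_2)$ are homeomorphic, written $X_1\cong X_2$ (as measurable spaces), if there is a bijection $\varphi:X_1\to X_2$ such that for every $A\subseteq X_1$, $A\in\mathcal{A}_1$ if and only if $\varphi(A)\in\mathcal{A}_2$. *)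

(* Defs.v *)
From HB Require Import structures.
From mathcomp Require Import all_boot all_order all_algebra.
From mathcomp Require Import all_classical all_reals all_analysis measurable_realfun.

Set Implicit Arguments.
Unset Strict Implicit.
Unset Printing Implicit Defensive.

Import numFieldNormedType.Exports.

Local Open Scope classical_set_scope.

(* The join of S in the lattice of measurable sets ordered by inclusion: the
   least measurable upper bound of S, which for an uncountable S need not be
   the union of S. *)
Definition measurable_join (d : measure_display) (X : measurableType d)
    (S : set (set X)) (J : set X) : Prop :=
  [/\ measurable J,
      (forall A, S A -> A `<=` J) &
      (forall B, measurable B -> (forall A, S A -> A `<=` B) -> J `<=` B)].

Definition compact_measurable_space (d : measure_display)
    (X : measurableType d) : Prop :=
  forall S : set (set X), S `<=` measurable ->
    measurable_join S [set: X] ->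
    exists T : set (set X),
      [/\ finite_set T, T `<=` S & measurable_join T [set: X]].

Definition T_measurable_space (d : measure_display) (X : measurableType d) : Prop :=
  forall x y : X, x <> y ->
    exists2 A : set X, measurable A & (A x /\ ~ A y) \/ (A y /\ ~ A x).

Definition measurable_homeomorphic (d d' : measure_display)
    (X : measurableType d) (Y : measurableType d') : Prop :=
  exists2 phi : X -> Y, bijective phi &
    forall A : set X, measurable A <-> measurable (phi @` A).

Definition ring_isomorphic (A B : pzRingType) : Prop :=
  exists f : {rmorphism A -> B}, bijective f.

(* The ring M(X) is {mfun X >-> R}; its elements, defined by measurability of
   preimages of Borel sets, are exactly the functions whose preimages of open
   sets are measurable. *)
Lemma measurable_fun_openP (R : realType) (d : measure_display)
    (X : measurableType d) (f : X -> R) :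
  measurable_fun [set: X] f <->
  forall V : set R, open V -> measurable (f @^-1` V).
Proof.
split=> [mf V oV|fV].
  by rewrite -[_ @^-1` _]setTI; apply: mf => //; exact: open_measurable.
apply: (measurability _ (RGenOpens.measurableE R)) => _ [_ [a [b ->] <-]].
by rewrite setTI; apply: fV; exact: interval_open.
Qed.

(* Main.v *)
Require Import Defs.
From HB Require Import structures.
From mathcomp Require Import all_boot all_order all_algebra.
From mathcomp Require Import all_classical all_reals all_analysis measurable_realfun.

(** Compactness of the lattice of measurable sets is a finiteness condition.
    If D_0, D_1, ... are disjoint nonempty measurable sets, then these sets
    together with the complement of their union join to the whole space, but
    a finite subfamily omits some D_n, and the measurable complement of D_n is
    then an upper bound of it ([compact_disjoint_sequence]).  In an infinite
    T-measurable space such a sequence exists: from an infinite measurable set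
    one can always remove a nonempty measurable part and stay infinite
    ([T_measurable_shrink]).  So a compact T-measurable space is finite, and
    since its points are separated by measurable sets, all its subsets are
    measurable ([compact_T_measurable_discrete]).

    It remains to recover the points of X from the ring M(X).  When singletons
    are measurable, the indicators of the singletons are exactly the primitive
    idempotents of M(X) ([point_indic_primitive], [primitive_point_indic]), and
    a ring isomorphism matches the primitive idempotents of the two rings.  An isomorphism
    M(X) ~ M(Y) therefore induces a bijection X -> Y
    ([ring_isomorphic_bijection]), which is a homeomorphism because every
    subset on either side is measurable.

    Conversely, composition with the inverse of a homeomorphism is a ring
    isomorphism ([homeomorphic_ring_isomorphic]), for arbitrary measurable
    spaces. *)

Set Implicit Arguments.
Unset Strict Implicit.
Unset Printing Implicit Defensive.

Import GRing.Theory.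

Local Open Scope classical_set_scope.
Local Open Scope ring_scope.

(** * Compact T-measurable spaces are finite and discrete *)

(** Were all D n nonempty, they would be pairwise distinct, and each would be
    missed by the other members of the partition that they generate; no finite
    subfamily of that partition can then join to the whole space. *)
Lemma compact_disjoint_sequence (d : measure_display) (X : measurableType d)
    (D : nat -> set X) :
  compact_measurable_space X -> (forall n, measurable (D n)) ->
  trivIset setT D -> exists n, D n = set0.
Proof.
move=> cX mD tD; apply: contrapT => nD0.
have D0 n : D n !=set0 by apply/set0P/eqP => Dn0; apply: nD0; exists n.
have mU : measurable (\bigcup_n D n) by exact: bigcup_measurable.
(* The last set completes the D n to a partition of X, so that the union, and
   hence the join, is the whole space. *)
pose S := range D `|` [set ~` \bigcup_n D n].
have mS : S `<=` measurable.
  by move=> _ [[n _ <-]|->] //; exact: measurableC.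
have jS : measurable_join S setT.
  split=> // B _ SB x _; have [[n _ Dnx]|Ux] := pselect ((\bigcup_n D n) x).
    by apply: (SB (D n)) => //; left; exists n.
  by apply: (SB (~` \bigcup_n D n)) => //; right.
have [T [fT TS [_ _ jT]]] := cX S mS jS.
have injD : injective D.
  move=> i j Dij; have [x Dix] := D0 i.
  by apply: (tD i j) => //; exists x; split=> //; rewrite -Dij.
have [n TDn] : exists n, ~ T (D n).
  apply: contrapT => /forallNP TD; apply: infinite_nat.
  rewrite (_ : setT = D @^-1` T); last first.
    by apply/seteqP; split=> // n _; exact: contrapT (TD n).
  by apply: finite_preimage => // i j _ _; exact: injD.
have [x Dnx] := D0 n.
apply: (jT (~` D n) _ _ x) => //; first exact: measurableC.
move=> A TA y Ay Dny; case: (TS _ TA) => [[m _ DmA]|AE]; last first.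
  by move: Ay; rewrite AE; apply; exists n.
apply: TDn; rewrite (tD n m) ?DmA//.
by exists y; split=> //; rewrite DmA.
Qed.

(** A measurable set A separating two points of E cuts E into two nonempty
    pieces, at least one of which is infinite: that one is E'. *)
Lemma T_measurable_shrink (d : measure_display) (X : measurableType d)
    (E : set X) :
  T_measurable_space X -> measurable E -> infinite_set E ->
  exists2 E' : set X, measurable E' /\ infinite_set E' &
    E' `<=` E /\ E `\` E' !=set0.
Proof.
move=> TX mE iE.
have [x Ex] : E !=set0 by exact: infinite_setN0.
have [y [Ey yx]] : exists y, E y /\ y <> x.
  apply: contrapT => /forallNP nE; apply: iE.
  apply: (@sub_finite_set _ _ [set x]) => // y Ey.
  by apply: contrapT => yx; apply: (nE y).
have [A [mA nEA nEcA]] : exists A : set X,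
    [/\ measurable A, E `&` A !=set0 & E `\` A !=set0].
  by have [A mA [[Ay Ax]|[Ax Ay]]] := TX y x yx; exists A;
    split=> //; [exists y|exists x|exists x|exists y].
have [fA|iA] := pselect (finite_set (E `&` A)).
  exists (E `\` A).
    split; first exact: measurableD.
    move=> fcA; apply: iE; rewrite -(setUIDK E A); first by rewrite finite_setU.
  split; first exact: subDsetl.
  by have [z [Ez Az]] := nEA; exists z; split=> // -[].
exists (E `&` A); first by split=> //; exact: measurableI.
split; first exact: subIsetl.
by have [z [Ez Az]] := nEcA; exists z; split=> // -[].
Qed.

(** Iterating [T_measurable_shrink] from the whole space gives a strictly
    decreasing sequence of measurable sets, whose successive differences
    contradict [compact_disjoint_sequence]. *)
Lemma compact_T_measurable_finite (d : measure_display) (X : measurableType d) :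
  compact_measurable_space X -> T_measurable_space X -> finite_set [set: X].
Proof.
move=> cX TX; apply: contrapT => iX.
pose big := {E : set X | measurable E /\ infinite_set E}.
have step (E : big) : exists E' : big,
    sval E' `<=` sval E /\ sval E `\` sval E' !=set0.
  case: E => E [mE iE].
  have [E' E'P sE'] := T_measurable_shrink TX mE iE.
  by exists (exist _ E' E'P).
have [next nextP] := choice step.
pose E n := iter n next (exist _ setT (conj measurableT iX) : big).
pose D n := sval (E n) `\` sval (E n.+1).
have decE i j : (i <= j)%N -> sval (E j) `<=` sval (E i).
  elim: j => [|j IH]; first by rewrite leqn0 => /eqP ->.
  rewrite leq_eqVlt => /predU1P[-> //|/IH]; apply: subset_trans.
  by have [] := nextP (E j).
have [n Dn0] : exists n, D n = set0.
  apply: (compact_disjoint_sequence cX).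
    by move=> n; apply: measurableD; [case: (svalP (E n))|case: (svalP (E n.+1))].
  have disjD i j x : D i x -> D j x -> (i <= j)%N.
    move=> [Ex _] [_ nEx]; rewrite leqNgt; apply/negP.
    by move=> /decE /(_ x Ex).
  move=> i j _ _ [x [Dix Djx]].
  by apply/eqP; rewrite eqn_leq !(disjD _ _ x).
by have [_] := nextP (E n); rewrite -/(D n) => /set0P/eqP.
Qed.

(** Finitely many points are separated from x by finitely many measurable sets
    containing x, whose intersection is the singleton of x. *)
Lemma measurable_point (d : measure_display) (X : measurableType d) :
  finite_set [set: X] -> T_measurable_space X ->
  forall x : X, measurable [set x].
Proof.
move=> fX TX x.
have sep y : exists A : set X, [/\ measurable A, A x & y <> x -> ~ A y].
  have [->|yx] := pselect (y = x); first by exists setT.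
  have [A mA [[Ay Ax]|[Ax Ay]]] := TX y x yx; last by exists A.
  by exists (~` A); split=> //; [exact: measurableC|move=> _ /(_ Ay)].
have [A AP] := choice sep.
rewrite (_ : [set x] = \bigcap_(y in setT) A y).
  by apply: fin_bigcap_measurable => // y _; have [] := AP y.
apply/seteqP; split=> [_ -> y _|y Ay]; first by have [] := AP y.
apply: contrapT => yx.
by have [_ _ /(_ yx)] := AP y; apply; exact: Ay.
Qed.

Lemma compact_T_measurable_discrete (d : measure_display)
    (X : measurableType d) :
  compact_measurable_space X -> T_measurable_space X ->
  forall A : set X, measurable A.
Proof.
move=> cX TX A; have fX := compact_T_measurable_finite cX TX.
rewrite (_ : A = \bigcup_(x in A) [set x]); last first.
  by rewrite (bigcup_imset1 A id) image_id.
apply: fin_bigcup_measurable; first exact: sub_finite_set fX.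
by move=> x _; exact: measurable_point.
Qed.

(** * Points as primitive idempotents *)

(** In a commutative ring the idempotents form a Boolean algebra, with product
    as meet; the primitive ones are its atoms. *)
Definition primitive_idempotent (A : pzRingType) (e : A) : Prop :=
  [/\ e <> 0, e * e = e &
      forall g, g * g = g -> g * e = 0 \/ g * e = e].

Lemma primitive_idempotent_rmorphism (A B : pzRingType)
    (f : {rmorphism A -> B}) (e : A) :
  bijective f -> primitive_idempotent (f e) <-> primitive_idempotent e.
Proof.
move=> fbij; have fI := bij_inj fbij; have [h _ hK] := fbij.
split=> -[e0 ee eP]; split=> [E||g gg].
- by apply: e0; rewrite E rmorph0.
- by apply: fI; rewrite rmorphM.
- have [||] := eP (f g); first by rewrite -rmorphM gg.
  + by rewrite -rmorphM -(rmorph0 f) => /fI; left.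
  + by rewrite -rmorphM => /fI; right.
- by apply: e0; apply: fI; rewrite E rmorph0.
- by rewrite -rmorphM ee.
have hg : h g * h g = h g by apply: fI; rewrite rmorphM hK.
by have [] := eP _ hg => /(congr1 f); rewrite rmorphM hK ?rmorph0; [left|right].
Qed.

Definition point_indic (R : realType) (d : measure_display)
    (X : measurableType d) (mX : forall x : X, measurable [set x]) (x : X) :
  {mfun X >-> R} := indic_mfun [set x] (mX x).

Section point_indicators.
Context (R : realType) (d : measure_display) (X : measurableType d).
Context (mX : forall x : X, measurable [set x]).
Local Notation delta := (@point_indic R d X mX).

Lemma point_indic_xx x : delta x x = 1.
Proof. by rewrite /point_indic /= mindicE mem_set. Qed.

Lemma point_indic_neq x y : y <> x -> delta x y = 0.
Proof. by move=> yx; rewrite /point_indic /= mindicE memNset. Qed.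

Lemma mul_point_indic x (g : {mfun X >-> R}) : g x = 1 -> g * delta x = delta x.
Proof.
move=> gx; apply/mfuneqP => y; rewrite mfunM /=.
have [->|yx] := pselect (y = x); first by rewrite gx mul1r.
by rewrite point_indic_neq// mulr0.
Qed.

Lemma mul_point_indic0 x (g : {mfun X >-> R}) : g x = 0 -> g * delta x = 0.
Proof.
move=> gx; apply/mfuneqP => y; rewrite mfunM /=.
have [->|yx] := pselect (y = x); first by rewrite gx mul0r.
by rewrite point_indic_neq// mulr0.
Qed.

Lemma mfun_idempotent01 (g : {mfun X >-> R}) (x : X) :
  g * g = g -> g x = 0 \/ g x = 1.
Proof.
move=> /mfuneqP/(_ x); rewrite mfunM /= => /eqP.
rewrite -subr_eq0 -[X in _ - X]mulr1 -mulrBr mulf_eq0 subr_eq0.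
by case/orP => /eqP ->; [left|right].
Qed.

Lemma point_indic_primitive x : primitive_idempotent (delta x).
Proof.
split=> [/mfuneqP/(_ x)||g gg].
- by rewrite point_indic_xx => /eqP; rewrite oner_eq0.
- by rewrite mul_point_indic// point_indic_xx.
by have [/mul_point_indic0|/mul_point_indic] := mfun_idempotent01 x gg; [left|right].
Qed.

(** A nonzero idempotent e takes the value 1 at some x; then delta x * e is
    delta x, which is nonzero, so primitivity forces e = delta x. *)
Lemma primitive_point_indic (e : {mfun X >-> R}) :
  primitive_idempotent e -> exists x, e = delta x.
Proof.
move=> [e0 ee eP].
have [x ex] : exists x, e x = 1.
  apply: contrapT => /forallNP e1; apply: e0; apply/mfuneqP => x.
  by have [|/e1] := mfun_idempotent01 x ee.
exists x; have dd : delta x * delta x = delta x.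
  by rewrite mul_point_indic// point_indic_xx.
have [] := eP _ dd; rewrite mulrC mul_point_indic//.
by have [] := point_indic_primitive x.
Qed.

Lemma point_indic_inj : injective delta.
Proof.
move=> x y xy; apply: contrapT => nxy; have := point_indic_xx x.
by rewrite xy point_indic_neq// => /esym/eqP; rewrite oner_eq0.
Qed.
End point_indicators.

(** The bijection sends x to the unique y for which the isomorphism maps the
    indicator of x to the indicator of y. *)
Lemma ring_isomorphic_bijection (R : realType) (d d' : measure_display)
    (X : measurableType d) (Y : measurableType d') :
  (forall x : X, measurable [set x]) -> (forall y : Y, measurable [set y]) ->
  ring_isomorphic {mfun X >-> R} {mfun Y >-> R} ->
  exists phi : X -> Y, bijective phi.
Proof.
move=> mX mY [f fbij]; have [h fK hK] := fbij.
have ex_phi x : exists y, f (point_indic R mX x) = point_indic R mY y.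
  apply: primitive_point_indic; apply/primitive_idempotent_rmorphism => //.
  exact: point_indic_primitive.
have ex_psi y : exists x, f (point_indic R mX x) = point_indic R mY y.
  have [|x hx] := @primitive_point_indic R d X mX (h (point_indic R mY y)).
    apply/(primitive_idempotent_rmorphism _ fbij).
    by rewrite hK; exact: point_indic_primitive.
  by exists x; rewrite -hx hK.
have [phi phiP] := choice ex_phi; have [psi psiP] := choice ex_psi.
exists phi; exists psi => [x|y].
  by apply/(@point_indic_inj R _ _ mX)/(bij_inj fbij); rewrite psiP phiP.
by apply: (@point_indic_inj R _ _ mY); rewrite -phiP psiP.
Qed.

(** * Pulling functions back along a homeomorphism *)

Section pullback.
Context (R : realType) (d d' : measure_display).
Context (X : measurableType d) (Y : measurableType d') (psi : {mfun Y >-> X}).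

Definition pullback (f : {mfun X >-> R}) : {mfun Y >-> R} := [mfun of f \o psi].

Lemma pullback_is_zmod_morphism : zmod_morphism pullback.
Proof. by move=> f g; apply/mfuneqP. Qed.

Lemma pullback_is_monoid_morphism : monoid_morphism pullback.
Proof. by split=> [|f g]; apply/mfuneqP. Qed.

HB.instance Definition _ := GRing.isZmodMorphism.Build
  {mfun X >-> R} {mfun Y >-> R} pullback pullback_is_zmod_morphism.
HB.instance Definition _ := GRing.isMonoidMorphism.Build
  {mfun X >-> R} {mfun Y >-> R} pullback pullback_is_monoid_morphism.

End pullback.

Lemma homeomorphic_ring_isomorphic (R : realType) (d d' : measure_display)
    (X : measurableType d) (Y : measurableType d') :
  measurable_homeomorphic X Y ->
  ring_isomorphic {mfun X >-> R} {mfun Y >-> R}.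
Proof.
move=> [phi [psi phiK psiK] mphi].
have mf : measurable_fun setT phi.
  move=> _ B mB; rewrite setTI; apply/mphi.
  by rewrite image_preimage// -subTset => y _; exists (psi y).
have mp : measurable_fun setT psi.
  move=> _ A mA; rewrite setTI.
  rewrite (_ : _ @^-1` A = phi @` A); first exact/mphi.
  by apply/seteqP; split=> [y Ay|_ [x Ax <-]] /=; [exists (psi y)|rewrite phiK].
pose Phi : {mfun X >-> Y} := mfun_Sub (mem_set mf).
pose Psi : {mfun Y >-> X} := mfun_Sub (mem_set mp).
exists (pullback Psi : {rmorphism _ -> _}); exists (pullback Phi) => g.
  by apply/mfuneqP => x /=; rewrite phiK.
by apply/mfuneqP => y /=; rewrite psiK.
Qed.

Theorem corollary5 (R : realType) (d d' : measure_display)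
    (X : measurableType d) (Y : measurableType d') :
  compact_measurable_space X -> T_measurable_space X ->
  compact_measurable_space Y -> T_measurable_space Y ->
  measurable_homeomorphic X Y <->
  ring_isomorphic {mfun X >-> R} {mfun Y >-> R}.
Proof.
move=> cX TX cY TY; split; first exact: homeomorphic_ring_isomorphic.
have dX := compact_T_measurable_discrete cX TX.
have dY := compact_T_measurable_discrete cY TY.
move=> /ring_isomorphic_bijection[//|//|phi phibij].
by exists phi.
Qed.
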